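(* Let $\mathcal{C}$ be an additive category with cokernels. Then $(\underline{\mathrm{mod}}(\mathcal{C}),\mathcal{D})$ is a torsion theory in $\mathrm{mod}(\mathcal{C})$.
   Context: $\mathcal{C}$ is a small category (relative to a fixed universe). $\mathrm{Mod}(\mathcal{C})$ is the category of additive functors $\mathcal{C}^{\mathrm{op}}\to\mathrm{Ab}$. A functor $F\in\mathrm{Mod}(\mathcal{C})$ is coherent if there is an exact sequence $\mathrm{Hom}_{\mathcal{C}}(-,A)\to\mathrm{Hom}_{\mathcal{C}}(-,B)\to F\to 0$ (a presentation of $F$) with $A,B\in\mathcal{C}$; $\mathrm{mod}(\mathcal{C})$ is the full subcategory of coherent functors. When $\mathcal{C}$ has cokernels, the Yoneda functor $h_{\mathcal{C}}:\mathcal{C}\to\mathrm{mod}(\mathcal{C})$, $A\mapsto\mathrm{Hom}_{\mathcal{C}}(-,A)$, has a left adjoint $v:\mathrm{mod}(\mathcal{C})\to\mathcal{C}$, given by $v(F)=\mathrm{Coker}(X\to Y)$ for a presentation $\mathrm{Hom}_{\mathcal{C}}(-,X)\to\mathrm{Hom}_{\mathcal{C}}(-,Y)\to F\to 0$. $\underline{\mathrm{mod}}(\mathcal{C})$ is the full subcategory of those $F\in\mathrm{mod}(\mathcal{C})$ with $v(F)=0$. $\mathcal{D}$ is the full subcategory of $\mathrm{mod}(\mathcal{C})$ consisting of all functors which send epimorphisms of $\mathcal{C}$ to monomorphisms of abelian groups. A pair $(\mathcal{T},\mathcal{F})$ of full subcategories of $\mathrm{mod}(\mathcal{C})$ is a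 torsion theory if $\mathcal{T}=\{X : \mathrm{Hom}(X,Y)=0 \text{ for all } Y\in\mathcal{F}\}$ and $\mathcal{F}=\{Y : \mathrm{Hom}(X,Y)=0\text{ for all } X\in\mathcal{T}\}$. *)

(* Defs.v *)
From HB Require Import structures.
From mathcomp Require Import all_boot ssralg.
From mathcomp Require Import boolp.

Set Implicit Arguments.
Unset Strict Implicit.
Unset Printing Implicit Defensive.

Import GRing.Theory.
Local Open Scope ring_scope.

(* Abelian groups are [zmodType]s.  Classically every type carries the choice
   structure that [zmodType] includes, so this is no restriction. *)
Record preadditive := Preadditive {
  obj :> Type;
  hom : obj -> obj -> zmodType;
  idm : forall A, hom A A;
  comp : forall A B D, hom B D -> hom A B -> hom A D;
  compA : forall A B D E (h : hom D E) (g : hom B D) (f : hom A B),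
    comp h (comp g f) = comp (comp h g) f;
  comp1m : forall A B (f : hom A B), comp (idm B) f = f;
  compm1 : forall A B (f : hom A B), comp f (idm A) = f;
  compDl : forall A B D (g g' : hom B D) (f : hom A B),
    comp (g + g') f = comp g f + comp g' f;
  compDr : forall A B D (g : hom B D) (f f' : hom A B),
    comp g (f + f') = comp g f + comp g f'
}.

Arguments hom {_} _ _.
Arguments idm {_} _.
Arguments comp {_} {_ _ _} _ _.

Declare Scope cat_scope.
Delimit Scope cat_scope with cat.
Notation "g \oc f" := (comp g f)
  (at level 40, left associativity) : cat_scope.
Local Open Scope cat_scope.

Section Category.
Variable C : preadditive.
Implicit Types A B D Z : C.

Definition zero_object Z : Prop :=
  forall A, (exists! f : hom Z A, True) /\ (exists! f : hom A Z, True).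

Definition biproduct A B P : Prop :=
  exists (i1 : hom A P) (i2 : hom B P) (p1 : hom P A) (p2 : hom P B),
    [/\ p1 \oc i1 = idm A, p2 \oc i2 = idm B, p2 \oc i1 = 0, p1 \oc i2 = 0
      & i1 \oc p1 + i2 \oc p2 = idm P].

Definition additive_category : Prop :=
  (exists Z, zero_object Z) /\ (forall A B, exists P, biproduct A B P).

Definition epi A B (f : hom A B) : Prop :=
  forall D (g h : hom B D), g \oc f = h \oc f -> g = h.

Record cokernel A B (f : hom A B) := Cokernel {
  coker : C;
  coker_map : hom B coker;
  coker_map0 : coker_map \oc f = 0;
  coker_univ : forall D (g : hom B D), g \oc f = 0 ->
    exists! h : hom coker D, h \oc coker_map = g
}.

Definition has_cokernels : Prop :=
  forall A B (f : hom A B), inhabited (cokernel f).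

(* Objects of Mod(C): additive functors from the opposite category of C to
   abelian groups. *)
Record module := Module {
  mobj :> C -> zmodType;
  mmap : forall A B, hom A B -> {additive mobj B -> mobj A};
  mmap1 : forall A (x : mobj A), mmap (idm A) x = x;
  mmap_comp : forall A B D (g : hom B D) (f : hom A B) (x : mobj D),
    mmap (g \oc f) x = mmap f (mmap g x);
  mmapD : forall A B (f g : hom A B) (x : mobj B),
    mmap (f + g) x = mmap f x + mmap g x
}.

Record nattrans (F G : module) := NatTrans {
  napp :> forall A, {additive F A -> G A};
  naturality : forall A B (f : hom A B) (x : F B),
    napp A (mmap F f x) = mmap G f (napp B x)
}.

Definition precomp X A B (f : hom A B) : hom B X -> hom A X :=
  fun g => g \oc f.

Lemma precomp_is_zmod_morphism X A B (f : hom A B) :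
  zmod_morphism (@precomp X A B f).
Proof.
move=> g g'; apply: (addIr (precomp f g')).
by rewrite -addrA addNr addr0 /precomp -compDl subrK.
Qed.

HB.instance Definition _ X A B (f : hom A B) :=
  GRing.isZmodMorphism.Build (hom B X) (hom A X) (@precomp X A B f)
    (@precomp_is_zmod_morphism X A B f).

Lemma yoneda1 X A (x : hom A X) : precomp (idm A) x = x.
Proof. exact: compm1. Qed.

Lemma yoneda_comp X A B D (g : hom B D) (f : hom A B) (x : hom D X) :
  precomp (g \oc f) x = precomp f (precomp g x).
Proof. exact: compA. Qed.

Lemma yonedaD X A B (f g : hom A B) (x : hom B X) :
  precomp (f + g) x = precomp f x + precomp g x.
Proof. exact: compDr. Qed.

(* Hom(-, X) *)
Definition yoneda X : module :=
  @Module (fun A => hom A X) (fun A B f => @precomp X A B f)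
    (@yoneda1 X) (@yoneda_comp X) (@yonedaD X).

(* An exact sequence Hom(-, A) -> Hom(-, B) -> F -> 0; exactness in Mod(C) is
   computed objectwise. *)
Record presentation (F : module) := Presentation {
  pres_src : C;
  pres_tgt : C;
  pres_map : nattrans (yoneda pres_src) (yoneda pres_tgt);
  pres_quo : nattrans (yoneda pres_tgt) F;
  pres_exact : forall X (y : yoneda pres_tgt X),
    pres_quo X y = 0 <-> exists x : yoneda pres_src X, pres_map X x = y;
  pres_surj : forall X (z : F X), exists y : yoneda pres_tgt X,
    pres_quo X y = z
}.

(* Objects of mod(C), a full subcategory of Mod(C): its morphisms are all the
   [nattrans] between the underlying modules. *)
Record coherent := Coherent {
  cmod :> module;
  cohP : inhabited (presentation cmod)
}.

(* The morphism of C which induces [pres_map], by the Yoneda lemma. *)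
Definition pres_hom (F : module) (p : presentation F) :
    hom (pres_src p) (pres_tgt p) :=
  pres_map p (pres_src p) (idm (pres_src p)).

(* The left adjoint v of the Yoneda functor, on objects.  The presentation and
   the cokernel are chosen; v F is unique up to isomorphism. *)
Definition v (cokC : has_cokernels) (F : coherent) : C :=
  coker (inhabited_witness
    (cokC _ _ (pres_hom (inhabited_witness (cohP F))))).

Definition under_mod (cokC : has_cokernels) (F : coherent) : Prop :=
  zero_object (v cokC F).

(* Monomorphisms of abelian groups are the injective homomorphisms. *)
Definition epi_to_mono (F : coherent) : Prop :=
  forall A B (f : hom A B), epi f -> injective (mmap F f).

Definition hom_zero (X Y : coherent) : Prop :=
  forall (t : nattrans X Y) A (x : X A), t A x = 0.

(* Full subcategories of mod(C) are given by their classes of objects. *)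
Definition torsion_theory (T F : coherent -> Prop) : Prop :=
  (forall X, T X <-> forall Y, F Y -> hom_zero X Y) /\
  (forall Y, F Y <-> forall X, T X -> hom_zero X Y).

End Category.

(* Main.v *)
Require Import Defs.
From HB Require Import structures.
From mathcomp Require Import all_boot ssralg generic_quotient ring_quotient.
From mathcomp Require Import boolp.

(** Take a presentation Hom(-, X) -> Hom(-, Y) -> F -> 0 whose first map is
induced by f : X -> Y.  By the Yoneda lemma, Hom(F, G) is the set of those w in
G(Y) with G(f) w = 0 ([eq0_of_gen], [hom_gen0], [descent_exists]), so it
vanishes if and only if G(f) is injective.  For the representable functors
G = Hom(-, D), where G(f) is precomposition with f, this says that f is an
epimorphism if and only if F has no nonzero map to a representable functor
([pres_hom_epiP]).

A morphism between objects of an additive category is an epimorphism if and only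
if its cokernel is zero, and v(F) = Coker f.  Hence v(F) = 0 if and only if F
has no nonzero map to a representable functor ([under_modP]).  Since that
condition mentions no presentation, it can be tested on every presentation of F.

The four inclusions follow.  If v(F) = 0 and G sends epimorphisms to
monomorphisms, then G(f) is injective, hence Hom(F, G) = 0
([hom_zero_epi_to_mono]); this gives one inclusion in each of the two equalities.
Representable functors send epimorphisms to monomorphisms, so a functor F with
no nonzero map to the torsion-free class has v(F) = 0.  Finally, let G receive
no nonzero map from the torsion class and let f : X -> Y be an epimorphism.
The functor F = Coker Hom(-, f) is coherent with v(F) = 0
([under_mod_coker]), and an element of the kernel of G(f) is the same as a map
F -> G, so it is zero. *)

Set Implicit Arguments.
Unset Strict Implicit.
Unset Printing Implicit Defensive.

Import GRing.Theory.
Local Open Scope ring_scope.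
Local Open Scope quotient_scope.
Local Open Scope cat_scope.

(** * Morphisms in a preadditive category *)

Section Torsion.
Variable C : preadditive.

Lemma comp0m (A B D : C) (f : hom A B) : (0 : hom B D) \oc f = 0.
Proof. exact: (raddf0 (@precomp C D A B f)). Qed.

Lemma comp_subl (A B D : C) (g h : hom B D) (f : hom A B) :
  (g - h) \oc f = g \oc f - h \oc f.
Proof. exact: (raddfB (@precomp C D A B f)). Qed.

Lemma compm0 (A B D : C) (g : hom B D) : g \oc (0 : hom A B) = 0.
Proof. by apply: (addrI (g \oc 0)); rewrite -compDr !addr0. Qed.

Lemma comp_subr (A B D : C) (g : hom B D) (f f' : hom A B) :
  g \oc (f - f') = g \oc f - g \oc f'.
Proof. by apply: (addIr (g \oc f')); rewrite -compDr !subrK. Qed.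

Lemma epi0P (A B : C) (f : hom A B) :
  epi f <-> forall D (g : hom B D), g \oc f = 0 -> g = 0.
Proof.
split=> [epif D g gf0 | f0 D g h /eqP].
  by apply: epif; rewrite gf0 comp0m.
by rewrite -subr_eq0 -comp_subl => /eqP /f0 /subr0_eq.
Qed.

Lemma mmapB (F : module C) (A B : C) (f g : hom A B) (x : F B) :
  mmap F (f - g) x = mmap F f x - mmap F g x.
Proof. by apply: (addIr (mmap F g x)); rewrite -mmapD !subrK. Qed.

Lemma zero_objectP (Z : C) : zero_object Z <-> idm Z = 0.
Proof.
split=> [/(_ Z)[[f [_ fu]] _] | Z0 A].
  by rewrite -(fu (idm Z)) // -(fu 0).
split; exists 0; split=> // g _.
  by rewrite -[g]compm1 Z0 compm0.
by rewrite -[g]comp1m Z0 comp0m.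
Qed.

(** A morphism g with g f = 0 factors through Coker f; conversely, the cokernel map
is itself such a g. *)
Lemma coker_zeroP (A B : C) (f : hom A B) (k : cokernel f) :
  zero_object (coker k) <-> epi f.
Proof.
rewrite zero_objectP epi0P; split=> [k0 D g gf0 | f0].
  have [h [<- _]] := coker_univ k gf0.
  by rewrite -[h]compm1 k0 compm0 comp0m.
have c0 := f0 _ _ (coker_map0 k).
have [h [_ hu]] := coker_univ k (coker_map0 k).
by rewrite -(hu (idm _)) ?comp1m // -(hu 0) // c0 compm0.
Qed.

(** * Maps out of a presented functor *)

Section Presentation.
Variables (F G : module C) (p : presentation F).

(** The universal element of the presentation: the image of the identity, which
generates F by the Yoneda lemma. *)
Definition gen : F (pres_tgt p) := pres_quo p _ (idm _).

Lemma pres_quoE A (y : hom A (pres_tgt p)) : pres_quo p A y = mmap F y gen.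
Proof. by rewrite -naturality /= /precomp comp1m. Qed.

Lemma pres_mapE A (x : hom A (pres_src p)) : pres_map p A x = pres_hom p \oc x.
Proof.
by have := naturality (pres_map p) x (idm _); rewrite /= /precomp comp1m.
Qed.

Lemma mmap_gen0 : mmap F (pres_hom p) gen = 0.
Proof.
by rewrite -pres_quoE pres_exact; exists (idm _); rewrite pres_mapE compm1.
Qed.

(** Every element of F is a restriction of [gen], so a map is determined by its
value there. *)
Lemma eq0_of_gen (t : nattrans F G) :
  t _ gen = 0 -> forall A (x : F A), t A x = 0.
Proof.
move=> t0 A x; have [y <-] := pres_surj p x.
by rewrite pres_quoE naturality t0 raddf0.
Qed.

Lemma hom_gen0 (t : nattrans F G) : mmap G (pres_hom p) (t _ gen) = 0.
Proof. by rewrite -naturality mmap_gen0 raddf0. Qed.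

(** The converse of [hom_gen0]: each y in Hom(A, Y) is sent to G(y) w, and this
depends only on the image of y in F(A). *)
Lemma descent_exists (w : G (pres_tgt p)) :
  mmap G (pres_hom p) w = 0 -> exists t : nattrans F G, t _ gen = w.
Proof.
move=> w0.
have wd A (y : hom A (pres_tgt p)) : pres_quo p A y = 0 -> mmap G y w = 0.
  by case/pres_exact=> x <-; rewrite pres_mapE mmap_comp w0 raddf0.
pose lift A (z : F A) := sval (cid (pres_surj p z)).
have liftK A (z : F A) : pres_quo p A (lift A z) = z.
  by rewrite /lift; case: cid.
pose u A (z : F A) : G A := mmap G (lift A z) w.
have uE A (y : hom A (pres_tgt p)) : u A (pres_quo p A y) = mmap G y w.
  by apply/subr0_eq; rewrite -mmapB; apply: wd; rewrite raddfB liftK subrr.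
have u_add A : zmod_morphism (@u A).
  by move=> z z'; rewrite -(liftK _ z) -(liftK _ z') -raddfB !uE mmapB.
pose U A : {additive F A -> G A} := HB.pack (@u A)
  (GRing.isZmodMorphism.Build _ _ (@u A) (@u_add A)).
have u_nat A B (f : hom A B) (z : F B) : U A (mmap F f z) = mmap G f (U B z).
  by rewrite -(liftK _ z) -naturality /= !uE mmap_comp.
exists (NatTrans u_nat); rewrite /= /gen uE; exact: mmap1.
Qed.

End Presentation.

(** * Representable functors *)

(** Hom(-, D) is the cokernel of the zero endomorphism of Hom(-, D). *)
Lemma yoneda_presentation (D : C) : presentation (yoneda D).
Proof.
pose z A : {additive yoneda D A -> yoneda D A} := \0.
pose i A : {additive yoneda D A -> yoneda D A} := idfun.
have z_nat A B (f : hom A B) (x : yoneda D B) :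
  z A (mmap (yoneda D) f x) = mmap (yoneda D) f (z B x).
  by rewrite raddf0.
have i_nat A B (f : hom A B) (x : yoneda D B) :
  i A (mmap (yoneda D) f x) = mmap (yoneda D) f (i B x) by [].
apply: (@Presentation _ (yoneda D) D D (NatTrans z_nat) (NatTrans i_nat)).
  by move=> X y; split=> [/= -> | [x <-]] //; exists 0.
by move=> X x; exists x.
Qed.

Definition coherent_yoneda (D : C) : coherent C :=
  Coherent (inhabits (yoneda_presentation D)).

Lemma yoneda_epi_to_mono (D : C) : epi_to_mono (coherent_yoneda D).
Proof. by move=> A B f epif g h; apply: epif. Qed.

(** The value w in G(Y) of such a map at the generator has G(f) w = 0, where f is
the epimorphism of the presentation. *)
Lemma hom_zero_epi_to_mono (F G : coherent C) (p : presentation F) :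
  epi (pres_hom p) -> epi_to_mono G -> hom_zero F G.
Proof.
move=> epip Gmono t; apply: (@eq0_of_gen _ _ p).
by apply: (Gmono _ _ _ epip); rewrite hom_gen0 raddf0.
Qed.

(** A morphism g : Y -> D with g f = 0 is the same as a map F -> Hom(-, D). *)
Lemma pres_hom_epiP (F : coherent C) (p : presentation F) :
  epi (pres_hom p) <-> forall D, hom_zero F (coherent_yoneda D).
Proof.
split=> [epip D | F0].
  exact: (@hom_zero_epi_to_mono F _ p epip (@yoneda_epi_to_mono D)).
apply/epi0P=> D g gp0.
have [t <-] := @descent_exists _ (yoneda D) p g gp0.
exact: (F0 D t).
Qed.

(** The object v F is built from a presentation chosen once and for all; the right
hand side does not depend on it, so v F = 0 can be tested on any other
presentation. *)
Lemma under_modP (cokC : has_cokernels C) (F : coherent C) :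
  under_mod cokC F <-> forall D, hom_zero F (coherent_yoneda D).
Proof. by rewrite /under_mod /v coker_zeroP pres_hom_epiP. Qed.

(** * The cokernel of a map of representable functors *)

Section CokernelModule.
Variables (X Y : C) (f : hom X Y).

Definition post_image A : {pred hom A Y} :=
  fun y => `[< exists x, f \oc x = y >].

Lemma post_imageP A (y : hom A Y) :
  y \in @post_image A <-> exists x, f \oc x = y.
Proof. by split=> /asboolP. Qed.

Lemma post_image_closed A : zmod_closed (@post_image A).
Proof.
split=> [|_ _ /post_imageP[x <-] /post_imageP[x' <-]]; apply/post_imageP.
  by exists 0; rewrite compm0.
by exists (x - x'); rewrite comp_subr.
Qed.

HB.instance Definition _ A :=
  GRing.isZmodClosed.Build (hom A Y) (@post_image A) (@post_image_closed A).

Definition coker_obj A : zmodType := Quotient.quot (@post_image A).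

Definition coker_pi A : {additive hom A Y -> coker_obj A} :=
  \pi_(Quotient.quot (@post_image A)).

Lemma coker_reprK A (z : coker_obj A) : coker_pi A (repr z) = z.
Proof. exact: reprK. Qed.

Lemma coker_pi_eq0 A (y : hom A Y) :
  coker_pi A y = 0 <-> exists x, f \oc x = y.
Proof.
rewrite -post_imageP -[y in y \in _]subr0 Quotient.idealrBE.
rewrite -(raddf0 (coker_pi A)).
by split=> [/eqP | /eqP].
Qed.

(** The representative is arbitrary; [coker_resE] removes the choice. *)
Definition coker_res A B (g : hom A B) (z : coker_obj B) : coker_obj A :=
  coker_pi A (repr z \oc g).

(** Two representatives differ by some f x, and (f x) g = f (x g). *)
Lemma coker_resE A B (g : hom A B) (y : hom B Y) :
  coker_res g (coker_pi B y) = coker_pi A (y \oc g).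
Proof.
apply/subr0_eq; rewrite -raddfB -comp_subl; apply/coker_pi_eq0.
have [|x xE] := (coker_pi_eq0 (repr (coker_pi B y) - y)).1.
  by rewrite raddfB coker_reprK subrr.
by exists (x \oc g); rewrite Defs.compA xE.
Qed.

Lemma coker_res_is_zmod_morphism A B (g : hom A B) :
  zmod_morphism (@coker_res A B g).
Proof.
move=> z z'; rewrite -(coker_reprK z) -(coker_reprK z').
by rewrite -raddfB !coker_resE comp_subl raddfB.
Qed.

HB.instance Definition _ A B (g : hom A B) :=
  GRing.isZmodMorphism.Build (coker_obj B) (coker_obj A) (@coker_res A B g)
    (@coker_res_is_zmod_morphism A B g).

Lemma coker_res1 A (z : coker_obj A) : coker_res (idm A) z = z.
Proof. by rewrite /coker_res compm1 coker_reprK. Qed.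

Lemma coker_res_comp A B D (g : hom B D) (h : hom A B) (z : coker_obj D) :
  coker_res (g \oc h) z = coker_res h (coker_res g z).
Proof. by rewrite [coker_res g z]/coker_res coker_resE -Defs.compA. Qed.

Lemma coker_resD A B (g h : hom A B) (z : coker_obj B) :
  coker_res (g + h) z = coker_res g z + coker_res h z.
Proof. by rewrite /coker_res compDr raddfD. Qed.

Definition coker_module : module C :=
  @Module C coker_obj (fun A B g => @coker_res A B g)
    coker_res1 coker_res_comp coker_resD.

Lemma postcomp_is_zmod_morphism A :
  zmod_morphism (fun x : hom A X => f \oc x).
Proof. by move=> x x'; rewrite comp_subr. Qed.

Definition postcomp A : {additive yoneda X A -> yoneda Y A} :=
  HB.pack (fun x : hom A X => f \oc x)
    (GRing.isZmodMorphism.Build (hom A X) (hom A Y) _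
       (@postcomp_is_zmod_morphism A)).

Lemma postcomp_natural A B (g : hom A B) (x : yoneda X B) :
  postcomp A (mmap (yoneda X) g x) = mmap (yoneda Y) g (postcomp B x).
Proof. exact: Defs.compA. Qed.

Lemma coker_pi_natural A B (g : hom A B) (y : yoneda Y B) :
  coker_pi A (mmap (yoneda Y) g y) = mmap coker_module g (coker_pi B y).
Proof. exact/esym/coker_resE. Qed.

Definition coker_presentation : presentation coker_module :=
  @Presentation C coker_module X Y (NatTrans postcomp_natural)
    (@NatTrans _ (yoneda Y) coker_module _ coker_pi_natural)
    (fun A y => coker_pi_eq0 y)
    (fun A z => ex_intro _ (repr z) (coker_reprK z)).

Lemma coker_pres_hom : pres_hom coker_presentation = f.
Proof. exact: compm1. Qed.

Definition coherent_coker : coherent C :=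
  Coherent (inhabits coker_presentation).

End CokernelModule.

(** * The torsion theory *)

Lemma under_mod_coker (cokC : has_cokernels C) (X Y : C) (f : hom X Y) :
  epi f -> under_mod cokC (coherent_coker f).
Proof.
move=> epif; apply/under_modP.
apply/(@pres_hom_epiP (coherent_coker f) (coker_presentation f)).
by rewrite coker_pres_hom.
Qed.

End Torsion.

Theorem proposition2p2 (C : preadditive) (addC : additive_category C)
    (cokC : has_cokernels C) :
  torsion_theory (under_mod cokC) (@epi_to_mono C).
Proof.
have homTD F G : under_mod cokC F -> epi_to_mono G -> hom_zero F G.
  move=> /under_modP F0; have [p] := cohP F.
  exact: hom_zero_epi_to_mono ((pres_hom_epiP p).2 F0).
split=> [F | G]; split.
- by move=> TF G; apply: homTD.
- by move=> F0; apply/under_modP=> D; apply/F0/yoneda_epi_to_mono.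
- by move=> DG F TF; apply: homTD.
move=> G0 A B f epif x y /eqP; rewrite -subr_eq0 -raddfB => /eqP xy0.
apply/subr0_eq.
(* The map t : Coker Hom(-, f) -> G that classifies x - y vanishes. *)
have := @descent_exists _ _ G (coker_presentation f) (x - y).
rewrite coker_pres_hom => /(_ xy0)[t <-].
exact: (G0 _ (under_mod_coker cokC epif) t).
Qed.
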